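(* Let $G$, $H$, $\Gamma$ be étale groupoids such that $G$ acts on the right on the groupoid $H$ (with moment map $p:H\to G^{(0)}$), and let $\rho:G\to\Gamma$ be a continuous groupoid homomorphism. Let $\pi:H\rtimes G\to G$ be the homomorphism $\pi(h,g)=g$. Then the groupoid $(H\rtimes G)\times_\pi G$ is similar to $H$, and the groupoid $(G\times_\rho\Gamma)\rtimes\Gamma$ is similar to $G$.
   Context: For a groupoid $G$, $G^{(0)}$ is the unit space, $d,t:G\to G^{(0)}$ are the domain and terminus maps, and $G^{(2)}$ is the set of composable pairs; $(g_1,g_2)\in G^{(2)}$ iff $d(g_1)=t(g_2)$. An étale groupoid is a topological groupoid whose terminus map (hence also domain map) is a local homeomorphism. Groupoid action on a groupoid. A topological groupoid $G$ acts on the right on a topological groupoid $H$ if there are a continuous open surjection $p:H\to G^{(0)}$ and a continuous map $H\ast G\to H$, $(h,g)\mapsto h\cdot g$, where $H\ast G=\{(h,g)\in H\times G: t(g)=p(h)\}$, such that: (i) $p(h\cdot g)=d(g)$ for all $(h,g)\in H\ast G$; (ii) if $(h,g_1)\in H\ast G$ and $(g_1,g_2)\in G^{(2)}$ then $(h,g_1g_2)\in H\ast G$ and $h\cdot(g_1g_2)=(h\cdot g_1)\cdot g_2$; (iii) if $(h_1,h_2)\in H^{(2)}$ and $(h_1h_2,g)\in H\ast G$ then $(h_1,g),(h_2,g)\in H\ast G$ and $(h_1h_2)\cdot g=(h_1\cdot g)(h_2\cdot g)$; (iv) $h\cdot p(h)=h$ for all $h\in H$. Semi-direct product. If $G$ acts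 on $H$ on the right, $H\rtimes G$ is the set $H\ast G$ (subspace topology) with multiplication $(h,g)(h'\cdot g,g')=(hh',gg')$, defined when $t(g')=d(g)$ and $d(h)=t(h')$, and inverse $(h,g)^{-1}=(h^{-1}\cdot g,g^{-1})$. Its unit space is identified with $H^{(0)}$. Skew product. For a continuous homomorphism $\rho:G\to\Gamma$, $G\times_\rho\Gamma$ is the set of $(g,\gamma)\in G\times\Gamma$ with $(\gamma,\rho(g))\in\Gamma^{(2)}$ (subspace topology), with multiplication $(g,\gamma)(g',\gamma\rho(g))=(gg',\gamma)$ for $(g,g')\in G^{(2)}$ and inverse $(g,\gamma)^{-1}=(g^{-1},\gamma\rho(g))$. Its unit space is $\{(u,\gamma)\in G^{(0)}\times\Gamma:\rho(u)=d(\gamma)\}$. Explicitly, $(H\rtimes G)\times_\pi G$ consists of the triples $(h,g,g')\in H\times G\times G$ with $p(h)=t(g)$ and $(g',g)\in G^{(2)}$, with operations $(h,g,g')(h',g'',g'g)=(h(h'\cdot g^{-1}),gg'',g')$ (defined when $t(g'')=d(g)$ and $d(h)\cdot g=t(h')$) and $(h,g,g')^{-1}=(h^{-1}\cdot g,g^{-1},g'g)$. The groupoid $\Gamma$ acts on the right on $G\times_\rho\Gamma$ by $(g,\gamma)\cdot\gamma'=(g,\gamma'^{-1}\gamma)$ for $t(\gamma')=t(\gamma)$ (with moment map $(g,\gamma)\mapsto t(\gamma)$). Explicitly, the corresponding semi-direct product $(G\times_\rho\Gamma)\rtimes\Gamma$ consists of the triples $(g,\gamma,\gamma')\in G\times\Gamma\times\Gamma$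 with $(\gamma,\rho(g))\in\Gamma^{(2)}$ and $t(\gamma')=t(\gamma)$ (subspace topology), with operations $(g,\gamma,\gamma')(g',\gamma'^{-1}\gamma\rho(g),\gamma'')=(gg',\gamma,\gamma'\gamma'')$ (defined when $(g,g')\in G^{(2)}$ and $(\gamma',\gamma'')\in\Gamma^{(2)}$) and $(g,\gamma,\gamma')^{-1}=(g^{-1},\gamma'^{-1}\gamma\rho(g),\gamma'^{-1})$. Similarity. Two continuous groupoid homomorphisms $\phi_1,\phi_2:G_1\to G_2$ are similar if there is a continuous function $\theta:G_1^{(0)}\to G_2$ such that $\theta(t(g))\phi_1(g)=\phi_2(g)\theta(d(g))$ for all $g\in G_1$. Two topological groupoids $G_1,G_2$ are similar if there exist continuous homomorphisms $\phi:G_1\to G_2$ and $\psi:G_2\to G_1$ such that $\psi\circ\phi$ is similar to $\mathrm{id}_{G_1}$ and $\phi\circ\psi$ is similar to $\mathrm{id}_{G_2}$. *)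

(* Defs.v *)
From mathcomp Require Import all_boot.
From mathcomp Require Import all_classical.
From mathcomp Require Import topology.

Set Implicit Arguments.
Unset Strict Implicit.
Unset Printing Implicit Defensive.

Local Open Scope classical_set_scope.

#[local] Arguments isSub.val_subdef : simpl never.

(* Subsets [A : set T] of a topological space are used as types through the
   coercion [set_type]; they carry the subspace topology, and [\val] is the
   inclusion.  No separation axiom and no point are required of the spaces. *)

(* A groupoid is presented by its arrows only, so G^(0) is the subset of those
   [u] with [gdom u = u] (see [gunits]).  The product is a total function whose
   values outside G^(2) are irrelevant: every law, and its continuity, is
   restricted to composable pairs. *)
Record topGroupoid := TopGroupoid {
  gcarrier :> topologicalType;
  gdom : gcarrier -> gcarrier;
  gter : gcarrier -> gcarrier;
  gmul : gcarrier -> gcarrier -> gcarrier;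
  ginv : gcarrier -> gcarrier;
  gdom_ter : forall x, gdom (gter x) = gter x;
  gter_dom : forall x, gter (gdom x) = gdom x;
  gdomM : forall x y, gdom x = gter y -> gdom (gmul x y) = gdom y;
  gterM : forall x y, gdom x = gter y -> gter (gmul x y) = gter x;
  gmulA : forall x y z, gdom x = gter y -> gdom y = gter z ->
    gmul x (gmul y z) = gmul (gmul x y) z;
  gmul_dom : forall x, gmul x (gdom x) = x;
  gmul_ter : forall x, gmul (gter x) x = x;
  gdomV : forall x, gdom (ginv x) = gter x;
  gterV : forall x, gter (ginv x) = gdom x;
  gmulV : forall x, gmul x (ginv x) = gter x;
  gmulVx : forall x, gmul (ginv x) x = gdom x;
  gmul_continuous :
    continuous (fun z : [set z : gcarrier * gcarrier | gdom z.1 = gter z.2] =>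
      gmul (\val z).1 (\val z).2);
  ginv_continuous : continuous ginv
}.

Arguments gdom {_} _.
Arguments gter {_} _.
Arguments gmul {_} _ _.
Arguments ginv {_} _.

Definition gcomp (G : topGroupoid) (x y : G) : Prop := gdom x = gter y.

Definition gunits (G : topGroupoid) : set G := [set u | gdom u = u].

Arguments gunits : clear implicits.

Lemma gdom_dom (G : topGroupoid) (x : G) : gdom (gdom x) = gdom x.
Proof. by rewrite -{1}(gter_dom x) gdom_ter gter_dom. Qed.

Lemma gter_ter (G : topGroupoid) (x : G) : gter (gter x) = gter x.
Proof. by rewrite -{1}(gdom_ter x) gter_dom gdom_ter. Qed.

Definition gdom0 (G : topGroupoid) (x : G) : gunits G :=
  SigSub (mem_set (gdom_dom x : gunits G (gdom x))).

Definition gter0 (G : topGroupoid) (x : G) : gunits G :=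
  SigSub (mem_set (gdom_ter x : gunits G (gter x))).

Definition local_homeomorphism (X Y : topologicalType) (f : X -> Y) : Prop :=
  forall x : X, exists U : set X,
    [/\ open U, U x, open (f @` U) & exists g : Y -> X,
      [/\ {within U, continuous f}, {within f @` U, continuous g} &
          forall z, U z -> g (f z) = z]].

Definition etale (G : topGroupoid) : Prop := local_homeomorphism (@gter0 G).

Record ghom (G1 G2 : topGroupoid) := GHom {
  ghom_fun :> G1 -> G2;
  ghom_comp : forall x y : G1, gcomp x y -> gcomp (ghom_fun x) (ghom_fun y);
  ghomM : forall x y : G1, gcomp x y ->
    ghom_fun (gmul x y) = gmul (ghom_fun x) (ghom_fun y);
  ghom_continuous : continuous ghom_fun
}.

(* The two [gcomp] conditions say that both sides of the defining equation of
   similarity are products of composable pairs. *)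
Definition hom_similar (G1 G2 : topGroupoid) (phi1 phi2 : G1 -> G2) : Prop :=
  exists theta : gunits G1 -> G2, continuous theta /\
    forall g : G1,
      [/\ gcomp (theta (gter0 g)) (phi1 g),
          gcomp (phi2 g) (theta (gdom0 g)) &
          gmul (theta (gter0 g)) (phi1 g) = gmul (phi2 g) (theta (gdom0 g))].

Definition similar (G1 G2 : topGroupoid) : Prop :=
  exists (phi : ghom G1 G2) (psi : ghom G2 G1),
    hom_similar (psi \o phi) (@id G1) /\ hom_similar (phi \o psi) (@id G2).

(* A right action of G on H, except that the moment map is not required to be
   an open surjection.  This is what the semi-direct product construction
   needs, and all that holds for the action of Gamma on a skew product: the
   moment map (g, gamma) |-> t(gamma) there is in general neither open nor
   surjective. *)
Record preaction (H G : topGroupoid) := PreAction {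
  moment : H -> gunits G;
  act : H -> G -> H;
  moment_continuous : continuous moment;
  act_continuous :
    continuous (fun z : [set z : H * G | gter z.2 = \val (moment z.1)] =>
      act (\val z).1 (\val z).2);
  moment_act : forall h g, gter g = \val (moment h) ->
    \val (moment (act h g)) = gdom g;
  actM : forall h g1 g2, gter g1 = \val (moment h) -> gcomp g1 g2 ->
    gter (gmul g1 g2) = \val (moment h) /\
    act h (gmul g1 g2) = act (act h g1) g2;
  act_mul : forall h1 h2 g, gcomp h1 h2 ->
    gter g = \val (moment (gmul h1 h2)) ->
    [/\ gter g = \val (moment h1), gter g = \val (moment h2),
        gcomp (act h1 g) (act h2 g) &
        act (gmul h1 h2) g = gmul (act h1 g) (act h2 g)];
  act_moment : forall h, act h (\val (moment h)) = h
}.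

Record action (H G : topGroupoid) := Action {
  action_pre :> preaction H G;
  moment_open : forall U : set H, open U -> open (moment action_pre @` U);
  moment_surj : forall u : gunits G, exists h : H, moment action_pre h = u
}.

Section GroupoidTheory.
Variable G : topGroupoid.
Implicit Types x y z : G.

Lemma gmul_cancell x y : gcomp x y -> gmul (ginv x) (gmul x y) = y.
Proof.
by move=> c; rewrite gmulA ?gdomV// gmulVx (c : gdom x = _) gmul_ter.
Qed.

Lemma gmul_cancellV x y : gter x = gter y -> gmul x (gmul (ginv x) y) = y.
Proof. by move=> c; rewrite gmulA ?gdomV ?gterV// gmulV c gmul_ter. Qed.

Lemma gcomp_unitr x y : gcomp x y -> gmul x y = x -> y = gdom x.
Proof. by move=> c e; rewrite -(gmul_cancell c) e gmulVx. Qed.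

Lemma gcomp_unitl x y : gcomp x y -> gmul x y = y -> x = gter y.
Proof.
move=> c e; have : gmul (gmul x y) (ginv y) = gmul y (ginv y) by rewrite e.
by rewrite -gmulA ?gterV// gmulV -(c : gdom x = _) gmul_dom.
Qed.

Lemma ginv_uniq x y : gcomp x y -> gmul x y = gter x -> y = ginv x.
Proof.
by move=> c e; rewrite -(gmul_cancell c) e -(gdomV x) gmul_dom.
Qed.

Lemma ginvM x y : gcomp x y -> ginv (gmul x y) = gmul (ginv y) (ginv x).
Proof.
move=> c; have c' : gdom x = gter y := c.
apply/esym/ginv_uniq.
  by rewrite /gcomp gdomM// gterM ?gdomV ?gterV.
have cV : gdom (ginv y) = gter (ginv x) by rewrite gdomV gterV.
have c2 : gdom y = gter (gmul (ginv y) (ginv x)) by rewrite gterM// gterV.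
by rewrite -gmulA// gmul_cancellV ?gterV// gmulV gterM.
Qed.

Lemma ginvK x : ginv (ginv x) = x.
Proof. by apply/esym/ginv_uniq; rewrite /gcomp ?gdomV// gmulVx gterV. Qed.

Lemma gunit_ter x : gdom x = x -> gter x = x.
Proof. by move=> e; rewrite -e gter_dom. Qed.

End GroupoidTheory.

Lemma continuous_val (X T : topologicalType) (A : set T) (f : X -> A) :
  continuous (fun x => \val (f x)) -> continuous f.
Proof.
move=> cf; apply/continuousP => _ [V oV <-].
by move/continuousP : cf => /(_ _ oV).
Qed.

Lemma val_continuous (T : topologicalType) (A : set T) :
  continuous (fun x : A => \val x).
Proof. exact: initial_continuous. Qed.

Lemma continuous_on_set_type (X T Y : topologicalType) (A : set T) (F : T -> Y)
    (f : X -> T) : continuous (fun z : A => F (\val z)) ->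
  continuous f -> (forall x, A (f x)) -> continuous (F \o f).
Proof.
move=> cF cf Af; pose f' x : A := SigSub (mem_set (Af x)).
have cf' : continuous f' by exact: continuous_val.
move=> x; apply: (@continuous_comp _ _ _ f' (fun z : A => F (\val z))).
  exact: cf'.
exact: cF.
Qed.

Section Continuity.
Variable X : topologicalType.

Lemma continuous_pair (T U : topologicalType) (f : X -> T) (g : X -> U) :
  continuous f -> continuous g -> continuous (fun x => (f x, g x)).
Proof. by move=> cf cg x; apply: cvg_pair; [exact: cf|exact: cg]. Qed.

Lemma continuous_compT (T U : topologicalType) (g : T -> U) (f : X -> T) :
  continuous g -> continuous f -> continuous (fun x => g (f x)).
Proof. by move=> cg cf x; apply: continuous_comp; [exact: cf|exact: cg]. Qed.

Lemma continuous_fst (T U : topologicalType) (f : X -> T * U) :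
  continuous f -> continuous (fun x => (f x).1).
Proof. by move=> cf x; apply: continuous_comp; [exact: cf|exact: cvg_fst]. Qed.

Lemma continuous_snd (T U : topologicalType) (f : X -> T * U) :
  continuous f -> continuous (fun x => (f x).2).
Proof. by move=> cf x; apply: continuous_comp; [exact: cf|exact: cvg_snd]. Qed.

Lemma continuous_sval (T : topologicalType) (A : set T) (f : X -> A) :
  continuous f -> continuous (fun x => \val (f x)).
Proof. exact: continuous_compT (@val_continuous _ _). Qed.

Lemma continuous_gmul (G : topGroupoid) (f g : X -> G) :
  continuous f -> continuous g -> (forall x, gcomp (f x) (g x)) ->
  continuous (fun x => gmul (f x) (g x)).
Proof.
move=> cf cg c.
exact: (continuous_on_set_type (F := fun z => gmul z.1 z.2)
  (@gmul_continuous G) (continuous_pair cf cg) c).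
Qed.

Lemma continuous_ginv (G : topGroupoid) (f : X -> G) :
  continuous f -> continuous (fun x => ginv (f x)).
Proof. exact: continuous_compT (@ginv_continuous _). Qed.

Lemma continuous_gter (G : topGroupoid) (f : X -> G) :
  continuous f -> continuous (fun x => gter (f x)).
Proof.
move=> cf; have -> : (fun x => gter (f x)) = fun x => gmul (f x) (ginv (f x)).
  by apply/funext => x; rewrite gmulV.
apply: continuous_gmul => //; first exact: continuous_ginv.
by move=> x; rewrite /gcomp gterV.
Qed.

Lemma continuous_gdom (G : topGroupoid) (f : X -> G) :
  continuous f -> continuous (fun x => gdom (f x)).
Proof.
move=> cf; have -> : (fun x => gdom (f x)) = fun x => gmul (ginv (f x)) (f x).
  by apply/funext => x; rewrite gmulVx.
apply: continuous_gmul => //; first exact: continuous_ginv.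
by move=> x; rewrite /gcomp gdomV.
Qed.

Lemma continuous_act (H G : topGroupoid) (a : preaction H G)
    (f : X -> H) (g : X -> G) : continuous f -> continuous g ->
  (forall x, gter (g x) = \val (moment a (f x))) ->
  continuous (fun x => act a (f x) (g x)).
Proof.
move=> cf cg c.
exact: (continuous_on_set_type (F := fun z => act a z.1 z.2)
  (@act_continuous _ _ a) (continuous_pair cf cg) c).
Qed.

End Continuity.

Section HomTheory.
Variables (G1 G2 : topGroupoid) (phi : ghom G1 G2).

Lemma ghom_ter x : phi (gter x) = gter (phi x).
Proof.
apply: gcomp_unitl; first by apply: ghom_comp; rewrite /gcomp gdom_ter.
by rewrite -ghomM ?gmul_ter// /gcomp gdom_ter.
Qed.

Lemma ghom_dom x : phi (gdom x) = gdom (phi x).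
Proof.
apply: gcomp_unitr; first by apply: ghom_comp; rewrite /gcomp gter_dom.
by rewrite -ghomM ?gmul_dom// /gcomp gter_dom.
Qed.

Lemma ghomV x : phi (ginv x) = ginv (phi x).
Proof.
have c : gcomp x (ginv x) by rewrite /gcomp gterV.
by apply: ginv_uniq; [exact: ghom_comp|rewrite -ghomM// gmulV ghom_ter].
Qed.

End HomTheory.

Section PreactionTheory.
Variables (H G : topGroupoid) (a : preaction H G).
Local Notation p h := (\val (moment a h)).
Implicit Types (h : H) (g : G).

Lemma moment_ter h : gter (p h) = p h.
Proof. by apply: gunit_ter; exact: (set_mem (valP (moment a h))). Qed.

Lemma moment_mul h1 h2 : gcomp h1 h2 ->
  p (gmul h1 h2) = p h1 /\ p (gmul h1 h2) = p h2.
Proof.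
by move=> c; have [] := act_mul c (moment_ter (gmul h1 h2)); rewrite moment_ter.
Qed.

Lemma moment_inv h : p (ginv h) = p h.
Proof.
have c : gcomp h (ginv h) by rewrite /gcomp gterV.
by have [<- <-] := moment_mul c.
Qed.

Lemma moment_gter h : p (gter h) = p h.
Proof.
have c : gcomp h (ginv h) by rewrite /gcomp gterV.
by have [+ _] := moment_mul c; rewrite gmulV.
Qed.

Lemma moment_gdom h : p (gdom h) = p h.
Proof. by rewrite -gterV moment_gter moment_inv. Qed.

Lemma act_gdom h g : gter g = p h -> act a (gdom h) g = gdom (act a h g).
Proof.
move=> e; have c : gcomp h (gdom h) by rewrite /gcomp gter_dom.
have [|_ _ c' e'] := @act_mul _ _ a _ _ g c; first by rewrite gmul_dom.
by apply: gcomp_unitr => //; rewrite -e' gmul_dom.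
Qed.

Lemma act_gter h g : gter g = p h -> act a (gter h) g = gter (act a h g).
Proof.
move=> e; have c : gcomp (gter h) h by rewrite /gcomp gdom_ter.
have [|_ _ c' e'] := @act_mul _ _ a _ _ g c; first by rewrite gmul_ter.
by apply: gcomp_unitl => //; rewrite -e' gmul_ter.
Qed.

Lemma act_ginv h g : gter g = p h -> act a (ginv h) g = ginv (act a h g).
Proof.
move=> e; have c : gcomp h (ginv h) by rewrite /gcomp gterV.
have [|_ _ c' e'] := @act_mul _ _ a _ _ g c.
  by rewrite gmulV moment_gter.
by apply: ginv_uniq => //; rewrite -e' gmulV act_gter.
Qed.

Lemma actMl h1 h2 g : gcomp h1 h2 -> gter g = p h1 ->
  act a (gmul h1 h2) g = gmul (act a h1 g) (act a h2 g).
Proof.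
by move=> c e; have [] := @act_mul _ _ a _ _ g c => //; have [-> _] := moment_mul c.
Qed.

Lemma actMr h g1 g2 : gter g1 = p h -> gcomp g1 g2 ->
  act a h (gmul g1 g2) = act a (act a h g1) g2.
Proof. by move=> e c; have [] := actM e c. Qed.

Lemma actK h g : gter g = p h -> act a (act a h g) (ginv g) = h.
Proof.
move=> e; rewrite -actMr// /gcomp ?gterV//.
by rewrite gmulV e act_moment.
Qed.

Lemma actKV h g : gdom g = p h -> act a (act a h (ginv g)) g = h.
Proof. by move=> e; rewrite -{2}(ginvK g) actK// gterV. Qed.

End PreactionTheory.

Section SemiDirect.
Variables (H G : topGroupoid) (a : preaction H G).
Local Notation p h := (\val (moment a h)).

(* H * G, the pairs (h, g) with t(g) = p(h).  In the operations below,
   [insubd x w] is the element of this subtype with value [w]; the default [x]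
   is reached only by the product of a non-composable pair. *)
Definition sd_set : set (H * G) := [set z | gter z.2 = p z.1].

Definition sd_dom (x : sd_set) : sd_set :=
  insubd x (act a (gdom (\val x).1) (\val x).2, gdom (\val x).2).

Definition sd_ter (x : sd_set) : sd_set :=
  insubd x (gter (\val x).1, gter (\val x).2).

Definition sd_inv (x : sd_set) : sd_set :=
  insubd x (act a (ginv (\val x).1) (\val x).2, ginv (\val x).2).

(* (h, g) (k, g') = (h (k . g^-1), g g'), from k = h' . g. *)
Definition sd_mul (x y : sd_set) : sd_set :=
  insubd x (gmul (\val x).1 (act a (\val y).1 (ginv (\val x).2)),
            gmul (\val x).2 (\val y).2).

Lemma sd_setP (x : sd_set) : gter (\val x).2 = p (\val x).1.
Proof. exact: (set_mem (valP x)). Qed.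

Lemma val_sd_dom x : \val (sd_dom x) =
  (act a (gdom (\val x).1) (\val x).2, gdom (\val x).2).
Proof.
rewrite insubdK//; apply/mem_set; rewrite /sd_set/=; have e := sd_setP x.
by rewrite gter_dom moment_act// moment_gdom.
Qed.

Lemma val_sd_ter x : \val (sd_ter x) = (gter (\val x).1, gter (\val x).2).
Proof.
rewrite insubdK//; apply/mem_set; rewrite /sd_set/=; have e := sd_setP x.
by rewrite gter_ter moment_gter.
Qed.

Lemma val_sd_inv x : \val (sd_inv x) =
  (act a (ginv (\val x).1) (\val x).2, ginv (\val x).2).
Proof.
rewrite insubdK//; apply/mem_set; rewrite /sd_set/=; have e := sd_setP x.
by rewrite gterV moment_act// moment_inv.
Qed.

Lemma sd_compP x y : sd_dom x = sd_ter y ->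
  [/\ gdom (\val x).2 = gter (\val y).2,
      gter (ginv (\val x).2) = p (\val y).1,
      p (act a (\val y).1 (ginv (\val x).2)) = p (\val x).1 &
      gdom (\val x).1 = gter (act a (\val y).1 (ginv (\val x).2))].
Proof.
move=> /(congr1 \val); rewrite val_sd_dom val_sd_ter => -[e1 e2].
have ex := sd_setP x; have ey := sd_setP y.
have eV : gter (ginv (\val x).2) = p (\val y).1 by rewrite gterV e2.
split=> //; first by rewrite moment_act// gdomV.
by rewrite -act_gter// -e1 actK// moment_gdom.
Qed.

Lemma sd_comp x y : gdom (\val x).2 = gter (\val y).2 ->
  gdom (\val x).1 = gter (act a (\val y).1 (ginv (\val x).2)) ->
  sd_dom x = sd_ter y.
Proof.
have ex := sd_setP x; have ey := sd_setP y.
move=> e1 e2; apply: val_inj; rewrite val_sd_dom val_sd_ter e1 e2; congr pair.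
by rewrite -act_gter ?gterV ?e1// actKV// moment_gter e1.
Qed.

Lemma val_sd_mul x y : sd_dom x = sd_ter y -> \val (sd_mul x y) =
  (gmul (\val x).1 (act a (\val y).1 (ginv (\val x).2)),
   gmul (\val x).2 (\val y).2).
Proof.
move=> /sd_compP[e1 e2 e3 e4]; rewrite insubdK//; apply/mem_set; rewrite /sd_set/=.
by rewrite gterM// sd_setP; have [->] := @moment_mul _ _ a _ _ e4.
Qed.

Lemma sd_dom_ter x : sd_dom (sd_ter x) = sd_ter x.
Proof.
apply: val_inj; rewrite val_sd_dom val_sd_ter/= !gdom_ter; congr pair.
by rewrite sd_setP -(moment_gter a (\val x).1) act_moment.
Qed.

Lemma sd_ter_dom x : sd_ter (sd_dom x) = sd_dom x.
Proof.
apply: val_inj; rewrite val_sd_ter val_sd_dom/= gter_dom; congr pair.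
by rewrite -act_gter ?gter_dom// sd_setP moment_gdom.
Qed.

Lemma sd_domM x y : sd_dom x = sd_ter y -> sd_dom (sd_mul x y) = sd_dom y.
Proof.
move=> c; have [e1 e2 e3 e4] := sd_compP c; have ex := sd_setP x.
have ey := sd_setP y; apply: val_inj; rewrite !val_sd_dom !val_sd_mul//=.
rewrite !gdomM//; congr pair.
rewrite -act_gdom// actMr// ?actKV// ?moment_gdom -?ey//.
by rewrite moment_act ?gdomV// moment_gdom.
Qed.

Lemma sd_terM x y : sd_dom x = sd_ter y -> sd_ter (sd_mul x y) = sd_ter x.
Proof.
move=> c; have [e1 e2 e3 e4] := sd_compP c.
by apply: val_inj; rewrite !val_sd_ter !val_sd_mul//= !gterM.
Qed.

Lemma sd_mulA x y z : sd_dom x = sd_ter y -> sd_dom y = sd_ter z ->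
  sd_mul x (sd_mul y z) = sd_mul (sd_mul x y) z.
Proof.
move=> cxy cyz; have [e1 e2 e3 e4] := sd_compP cxy.
have [f1 f2 f3 f4] := sd_compP cyz.
have ex := sd_setP x; have ey := sd_setP y; have ez := sd_setP z.
apply: val_inj; rewrite !val_sd_mul ?sd_domM ?sd_terM//=.
rewrite (gmulA e1 f1); congr pair.
rewrite ginvM// actMr//; last by rewrite /gcomp gdomV gterV.
rewrite actMl//.
rewrite gmulA//.
by rewrite -!act_gdom// f4 act_gter// f3.
Qed.

Lemma sd_mul_dom x : sd_mul x (sd_dom x) = x.
Proof.
apply: val_inj; rewrite val_sd_mul ?sd_ter_dom// val_sd_dom/=.
rewrite gmul_dom actK ?sd_setP ?moment_gdom// gmul_dom.
by case: (\val x).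
Qed.

Lemma sd_mul_ter x : sd_mul (sd_ter x) x = x.
Proof.
apply: val_inj; rewrite val_sd_mul ?sd_dom_ter// val_sd_ter/=.
rewrite gmul_ter.
have -> : ginv (gter (\val x).2) = p (\val x).1.
  rewrite -sd_setP; apply/esym/ginv_uniq; rewrite /gcomp ?gdom_ter ?gter_ter//.
  by rewrite -{2}[gter _]gdom_ter gmul_dom.
by rewrite act_moment gmul_ter; case: (\val x).
Qed.

Lemma sd_domV x : sd_dom (sd_inv x) = sd_ter x.
Proof.
have ex := sd_setP x; apply: val_inj.
rewrite val_sd_dom val_sd_ter val_sd_inv/= gdomV; congr pair.
by rewrite -act_gdom ?moment_inv// gdomV actK// moment_gter.
Qed.

Lemma sd_terV x : sd_ter (sd_inv x) = sd_dom x.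
Proof.
have ex := sd_setP x; apply: val_inj.
rewrite val_sd_dom val_sd_ter val_sd_inv/= gterV; congr pair.
by rewrite -act_gter ?moment_inv// gterV.
Qed.

Lemma sd_mulV x : sd_mul x (sd_inv x) = sd_ter x.
Proof.
have ex := sd_setP x; apply: val_inj.
rewrite val_sd_mul ?sd_terV// val_sd_inv val_sd_ter/= gmulV; congr pair.
by rewrite actK ?moment_inv// gmulV.
Qed.

Lemma sd_mulVx x : sd_mul (sd_inv x) x = sd_dom x.
Proof.
have ex := sd_setP x; apply: val_inj.
rewrite val_sd_mul ?sd_domV// val_sd_inv val_sd_dom/= gmulVx; congr pair.
by rewrite ginvK act_ginv// gmulVx act_gdom.
Qed.

Lemma sd_mul_continuous :
  continuous (fun z : [set z : sd_set * sd_set | sd_dom z.1 = sd_ter z.2] =>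
    sd_mul (\val z).1 (\val z).2).
Proof.
apply: continuous_val.
rewrite (_ : (fun _ => _) = fun z : [set z | sd_dom z.1 = sd_ter z.2] =>
  (gmul (\val (\val z).1).1
        (act a (\val (\val z).2).1 (ginv (\val (\val z).1).2)),
   gmul (\val (\val z).1).2 (\val (\val z).2).2)); last first.
  by apply/funext => z; rewrite val_sd_mul//; exact: (set_mem (valP z)).
have c (z : [set z : sd_set * sd_set | sd_dom z.1 = sd_ter z.2]) :=
  sd_compP (set_mem (valP z) : sd_dom (\val z).1 = sd_ter (\val z).2).
have cv := @val_continuous _ [set z : sd_set * sd_set | sd_dom z.1 = sd_ter z.2].
have c1 := continuous_sval (continuous_fst cv).
have c2 := continuous_sval (continuous_snd cv).
have c11 := continuous_fst c1; have c12 := continuous_snd c1.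
have c21 := continuous_fst c2; have c22 := continuous_snd c2.
apply: continuous_pair; apply: continuous_gmul => //.
- apply: continuous_act => //; first exact: continuous_ginv.
  by move=> z; have [] := c z.
- by move=> z; have [] := c z.
- by move=> z; have [] := c z.
Qed.

Lemma sd_inv_continuous : continuous sd_inv.
Proof.
apply: continuous_val; rewrite (funext val_sd_inv).
have c1 := continuous_fst (@val_continuous _ sd_set).
have c2 := continuous_snd (@val_continuous _ sd_set).
apply: continuous_pair; last exact: continuous_ginv.
apply: continuous_act => //; first exact: continuous_ginv.
by move=> x; rewrite moment_inv sd_setP.
Qed.

Definition semidirect : topGroupoid :=
  TopGroupoid sd_dom_ter sd_ter_dom sd_domM sd_terM sd_mulA sd_mul_dom
    sd_mul_ter sd_domV sd_terV sd_mulV sd_mulVx sd_mul_continuous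
    sd_inv_continuous.

Lemma sd_proj_comp (x y : semidirect) :
  gcomp x y -> gcomp (\val x).2 (\val y).2.
Proof. by move=> /sd_compP[]. Qed.

Lemma sd_projM (x y : semidirect) :
  gcomp x y -> (\val (gmul x y)).2 = gmul (\val x).2 (\val y).2.
Proof. by move=> c; rewrite val_sd_mul. Qed.

Lemma sd_proj_continuous : continuous (fun x : semidirect => (\val x).2).
Proof. exact: continuous_snd (@val_continuous _ sd_set). Qed.

Definition sd_proj : ghom semidirect G :=
  @GHom semidirect G (fun x => (\val x).2) sd_proj_comp sd_projM
    sd_proj_continuous.

End SemiDirect.

Section SkewProduct.
Variables (G Gamma : topGroupoid) (rho : ghom G Gamma).

Definition skew_set : set (G * Gamma) := [set z | gcomp z.2 (rho z.1)].

Definition skew_dom (x : skew_set) : skew_set :=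
  insubd x (gdom (\val x).1, gmul (\val x).2 (rho (\val x).1)).

Definition skew_ter (x : skew_set) : skew_set :=
  insubd x (gter (\val x).1, (\val x).2).

Definition skew_inv (x : skew_set) : skew_set :=
  insubd x (ginv (\val x).1, gmul (\val x).2 (rho (\val x).1)).

Definition skew_mul (x y : skew_set) : skew_set :=
  insubd x (gmul (\val x).1 (\val y).1, (\val x).2).

Lemma skew_setP (x : skew_set) : gcomp (\val x).2 (rho (\val x).1).
Proof. exact: (set_mem (valP x)). Qed.

Lemma val_skew_dom x : \val (skew_dom x) =
  (gdom (\val x).1, gmul (\val x).2 (rho (\val x).1)).
Proof.
rewrite insubdK//; apply/mem_set; have e := skew_setP x.
by rewrite /skew_set /gcomp/= gdomM// ghom_dom gter_dom.
Qed.

Lemma val_skew_ter x : \val (skew_ter x) = (gter (\val x).1, (\val x).2).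
Proof.
rewrite insubdK//; apply/mem_set; have e := skew_setP x.
by rewrite /skew_set /gcomp/= ghom_ter gter_ter.
Qed.

Lemma val_skew_inv x : \val (skew_inv x) =
  (ginv (\val x).1, gmul (\val x).2 (rho (\val x).1)).
Proof.
rewrite insubdK//; apply/mem_set; have e := skew_setP x.
by rewrite /skew_set /gcomp/= gdomM// ghomV gterV.
Qed.

Lemma skew_compP x y : skew_dom x = skew_ter y <->
  gcomp (\val x).1 (\val y).1 /\
  (\val y).2 = gmul (\val x).2 (rho (\val x).1).
Proof.
split=> [/(congr1 \val)|[e1 e2]].
  by rewrite val_skew_dom val_skew_ter => -[].
by apply: val_inj; rewrite val_skew_dom val_skew_ter e1 e2.
Qed.

Lemma val_skew_mul x y : skew_dom x = skew_ter y ->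
  \val (skew_mul x y) = (gmul (\val x).1 (\val y).1, (\val x).2).
Proof.
move=> /skew_compP[e1 e2]; have ex := skew_setP x.
rewrite insubdK//; apply/mem_set.
by rewrite /skew_set /gcomp/= ghomM// gterM//; exact: ghom_comp.
Qed.

Lemma skew_dom_ter x : skew_dom (skew_ter x) = skew_ter x.
Proof.
apply: val_inj; rewrite val_skew_dom val_skew_ter/= gdom_ter; congr pair.
by rewrite ghom_ter -(skew_setP x : gdom _ = _) gmul_dom.
Qed.

Lemma skew_ter_dom x : skew_ter (skew_dom x) = skew_dom x.
Proof. by apply: val_inj; rewrite val_skew_ter val_skew_dom/= gter_dom. Qed.

Lemma skew_domM x y :
  skew_dom x = skew_ter y -> skew_dom (skew_mul x y) = skew_dom y.
Proof.
move=> c; have /skew_compP[e1 e2] := c; have ex := skew_setP x.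
apply: val_inj; rewrite !val_skew_dom !val_skew_mul//= gdomM// e2.
by rewrite ghomM// gmulA//; exact: ghom_comp.
Qed.

Lemma skew_terM x y :
  skew_dom x = skew_ter y -> skew_ter (skew_mul x y) = skew_ter x.
Proof.
move=> c; have /skew_compP[e1 e2] := c.
by apply: val_inj; rewrite !val_skew_ter !val_skew_mul//= gterM.
Qed.

Lemma skew_mulA x y z : skew_dom x = skew_ter y -> skew_dom y = skew_ter z ->
  skew_mul x (skew_mul y z) = skew_mul (skew_mul x y) z.
Proof.
move=> c c'; have /skew_compP[e1 _] := c; have /skew_compP[f1 _] := c'.
by apply: val_inj; rewrite !val_skew_mul ?skew_domM ?skew_terM//= gmulA.
Qed.

Lemma skew_mul_dom x : skew_mul x (skew_dom x) = x.
Proof.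
apply: val_inj; rewrite val_skew_mul ?skew_ter_dom// val_skew_dom/= gmul_dom.
by case: (\val x).
Qed.

Lemma skew_mul_ter x : skew_mul (skew_ter x) x = x.
Proof.
apply: val_inj; rewrite val_skew_mul ?skew_dom_ter// val_skew_ter/= gmul_ter.
by case: (\val x).
Qed.

Lemma skew_domV x : skew_dom (skew_inv x) = skew_ter x.
Proof.
have ex := skew_setP x; apply: val_inj.
rewrite val_skew_dom val_skew_ter val_skew_inv/= gdomV ghomV; congr pair.
by rewrite -gmulA ?gterV// gmulV -(ex : gdom _ = _) gmul_dom.
Qed.

Lemma skew_terV x : skew_ter (skew_inv x) = skew_dom x.
Proof.
by apply: val_inj; rewrite val_skew_dom val_skew_ter val_skew_inv/= gterV.
Qed.

Lemma skew_mulV x : skew_mul x (skew_inv x) = skew_ter x.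
Proof.
apply: val_inj; rewrite val_skew_mul ?skew_terV// val_skew_inv val_skew_ter/=.
by rewrite gmulV.
Qed.

Lemma skew_mulVx x : skew_mul (skew_inv x) x = skew_dom x.
Proof.
apply: val_inj; rewrite val_skew_mul ?skew_domV// val_skew_inv val_skew_dom/=.
by rewrite gmulVx.
Qed.

Lemma skew_mul_continuous : continuous
  (fun z : [set z : skew_set * skew_set | skew_dom z.1 = skew_ter z.2] =>
    skew_mul (\val z).1 (\val z).2).
Proof.
apply: continuous_val.
rewrite (_ : (fun _ => _) = fun z : [set z | skew_dom z.1 = skew_ter z.2] =>
  (gmul (\val (\val z).1).1 (\val (\val z).2).1,
   (\val (\val z).1).2)); last first.
  by apply/funext => z; rewrite val_skew_mul//; exact: (set_mem (valP z)).
have cv := @val_continuous _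
  [set z : skew_set * skew_set | skew_dom z.1 = skew_ter z.2].
have c1 := continuous_sval (continuous_fst cv).
have c2 := continuous_sval (continuous_snd cv).
apply: continuous_pair; last exact: continuous_snd.
apply: continuous_gmul; [exact: continuous_fst|exact: continuous_fst|].
by move=> z; have /skew_compP[] := set_mem (valP z).
Qed.

Lemma skew_inv_continuous : continuous skew_inv.
Proof.
apply: continuous_val; rewrite (funext val_skew_inv).
have c1 := continuous_fst (@val_continuous _ skew_set).
have c2 := continuous_snd (@val_continuous _ skew_set).
apply: continuous_pair; first exact: continuous_ginv.
apply: continuous_gmul => //; last exact: skew_setP.
exact: continuous_compT (@ghom_continuous _ _ rho) c1.
Qed.

Definition skew : topGroupoid :=
  TopGroupoid skew_dom_ter skew_ter_dom skew_domM skew_terM skew_mulA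
    skew_mul_dom skew_mul_ter skew_domV skew_terV skew_mulV skew_mulVx
    skew_mul_continuous skew_inv_continuous.

Definition skew_moment (x : skew) : gunits Gamma := gter0 (\val x).2.

Lemma val_skew_moment x : \val (skew_moment x) = gter (\val x).2.
Proof. by []. Qed.

(* The default [x] of [insubd] is reached only if t(gamma') <> t(gamma). *)
Definition skew_act (x : skew) (c : Gamma) : skew :=
  insubd x ((\val x).1, gmul (ginv c) (\val x).2).

Lemma val_skew_act x c : gter c = \val (skew_moment x) ->
  \val (skew_act x c) = ((\val x).1, gmul (ginv c) (\val x).2).
Proof.
move=> /= e; have ex := skew_setP x; rewrite insubdK//; apply/mem_set.
by rewrite /skew_set /gcomp/= gdomM// gdomV.
Qed.

Lemma skew_moment_continuous : continuous skew_moment.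
Proof.
apply: continuous_val; apply: continuous_gter.
exact: continuous_snd (@val_continuous _ skew_set).
Qed.

Lemma skew_act_continuous : continuous
  (fun z : [set z : skew * Gamma | gter z.2 = \val (skew_moment z.1)] =>
    skew_act (\val z).1 (\val z).2).
Proof.
apply: continuous_val.
rewrite (_ : (fun _ => _) =
  fun z : [set z : skew * Gamma | gter z.2 = \val (skew_moment z.1)] =>
  ((\val (\val z).1).1, gmul (ginv (\val z).2) (\val (\val z).1).2)); last first.
  by apply/funext => z; rewrite val_skew_act//; exact: (set_mem (valP z)).
have cv := @val_continuous _
  [set z : skew * Gamma | gter z.2 = \val (skew_moment z.1)].
have c1 := @continuous_sval _ _ skew_set _ (continuous_fst cv).
apply: continuous_pair; first exact: continuous_fst.
apply: continuous_gmul; [|exact: continuous_snd|].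
  by apply: continuous_ginv; exact: continuous_snd.
by move=> z; rewrite /gcomp gdomV; exact: (set_mem (valP z)).
Qed.

Lemma skew_moment_act x c : gter c = \val (skew_moment x) ->
  \val (skew_moment (skew_act x c)) = gdom c.
Proof. by move=> e; rewrite val_skew_moment val_skew_act//= gterM ?gdomV// gterV. Qed.

Lemma skew_actM x c1 c2 : gter c1 = \val (skew_moment x) -> gcomp c1 c2 ->
  gter (gmul c1 c2) = \val (skew_moment x) /\
  skew_act x (gmul c1 c2) = skew_act (skew_act x c1) c2.
Proof.
move=> e c; have e' : gter (gmul c1 c2) = \val (skew_moment x) by rewrite gterM.
split=> //; apply: val_inj.
rewrite !val_skew_act//=; last by rewrite skew_moment_act.
by rewrite ginvM// gmulA// ?gdomV ?gterV.
Qed.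

Lemma skew_act_mul x y c : gcomp x y ->
  gter c = \val (skew_moment (gmul x y)) ->
  [/\ gter c = \val (skew_moment x), gter c = \val (skew_moment y),
      gcomp (skew_act x c) (skew_act y c) &
      skew_act (gmul x y) c = gmul (skew_act x c) (skew_act y c)].
Proof.
move=> cxy e; have /skew_compP[e1 e2] := cxy; have ex := skew_setP x.
have ec : gter c = \val (skew_moment x).
  by rewrite e !val_skew_moment val_skew_mul.
have ec' : gter c = \val (skew_moment y).
  by rewrite ec !val_skew_moment e2 gterM.
have cc : gcomp (skew_act x c) (skew_act y c).
  by apply/skew_compP; rewrite !val_skew_act//= e2 gmulA// gdomV.
split=> //; apply: val_inj.
by rewrite val_skew_act// !val_skew_mul// !val_skew_act.
Qed.

Lemma skew_act_moment x : skew_act x (\val (skew_moment x)) = x.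
Proof.
apply: val_inj; rewrite val_skew_act val_skew_moment ?gter_ter//=.
have -> : ginv (gter (\val x).2) = gter (\val x).2.
  apply/esym/ginv_uniq; rewrite /gcomp ?gdom_ter ?gter_ter//.
  by rewrite -{2}[gter _]gdom_ter gmul_dom.
by rewrite gmul_ter; case: (\val x).
Qed.

Definition skew_preaction : preaction skew Gamma :=
  PreAction skew_moment_continuous skew_act_continuous skew_moment_act
    skew_actM skew_act_mul skew_act_moment.

End SkewProduct.

(* Main.v *)
Require Import Defs.
From mathcomp Require Import all_boot.
From mathcomp Require Import all_classical.
From mathcomp Require Import topology.

(** Both similarities are given by explicit formulas.

    For (H x| G) x_pi G, with elements (h, g, g') such that
    p(h) = t(g) = d(g'), take
      phi(h, g, g') = h . g'^-1,   psi(h) = (h, p(h), p(h)).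
    Then phi o psi is the identity of H, and psi o phi is similar to the
    identity through theta(u, v, w) = (u, w^-1, w): both sides of the similarity
    equation at (h, g, g') equal (h, g'^-1, g').

    For (G x_rho Gamma) x| Gamma, with elements (g, c, c') such that
    d(c) = t(rho(g)) and t(c') = t(c), take
      phi(g, c, c') = g,   psi(g) = (g, rho(t(g)), rho(g)).
    Then phi o psi is the identity of G, and psi o phi is similar to the
    identity through theta(u, c, c') = (u, c, c): both sides of the similarity
    equation at (g, c, c') equal (g, c, c rho(g)).

    The formulas for theta make sense, and are continuous, on the whole groupoid
    rather than only on its units (with t(u) in place of u in the second one),
    so the maps theta are defined there and then restricted. *)

Set Implicit Arguments.
Unset Strict Implicit.
Unset Printing Implicit Defensive.

Local Open Scope classical_set_scope.

#[local] Arguments isSub.val_subdef : simpl never.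

(** * Groupoids and similarity *)

Lemma ginv_gter (G : topGroupoid) (x : G) : ginv (gter x) = gter x.
Proof.
apply/esym/ginv_uniq; rewrite /gcomp ?gdom_ter ?gter_ter//.
by rewrite -{2}[gter x]gdom_ter gmul_dom.
Qed.

(** A similarity may be given by a map theta defined on the whole of G1: only
    its restriction to the units matters. *)
Lemma hom_similar_restrict (G1 G2 : topGroupoid) (phi1 phi2 theta : G1 -> G2) :
  continuous theta ->
  (forall g, [/\ gcomp (theta (gter g)) (phi1 g),
                 gcomp (phi2 g) (theta (gdom g)) &
                 gmul (theta (gter g)) (phi1 g) =
                 gmul (phi2 g) (theta (gdom g))]) ->
  hom_similar phi1 phi2.
Proof.
move=> ct h; exists (fun u => theta (\val u)); split; last exact: h.
exact: continuous_compT ct (@val_continuous _ (gunits G1)).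
Qed.

Lemma hom_similar_id (G : topGroupoid) (phi : G -> G) :
  phi =1 id -> hom_similar phi id.
Proof.
move=> e; apply: (@hom_similar_restrict _ _ _ _ id) => [x|g]; first exact.
by rewrite /gcomp !e gdom_ter gter_dom gmul_ter gmul_dom.
Qed.

(** * Elements of semi-direct and skew products *)

Section SemidirectElements.
Variables (H G : topGroupoid) (a : preaction H G).
Local Notation p h := (\val (moment a h)).

(** The element (h, g) of H x| G. *)
Definition sd_elt (h : H) (g : G) (e : gter g = p h) : semidirect a :=
  SigSub (mem_set (e : sd_set a (h, g))).

Lemma sd_comp_intro (x y : semidirect a) :
  gdom (\val x).2 = gter (\val y).2 ->
  act a (gdom (\val x).1) (\val x).2 = gter (\val y).1 -> gcomp x y.
Proof.
by move=> e1 e2; apply: val_inj; rewrite val_sd_dom val_sd_ter e1 e2.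
Qed.

End SemidirectElements.

Section SkewElements.
Variables (G Gamma : topGroupoid) (rho : ghom G Gamma).

(** The element (g, c) of G x_rho Gamma. *)
Definition skew_elt (g : G) (c : Gamma) (e : gcomp c (rho g)) : skew rho :=
  SigSub (mem_set (e : skew_set rho (g, c))).

End SkewElements.

(** * Skew product of a semi-direct product *)

Section SkewSemidirect.
Variables (H G : topGroupoid) (a : preaction H G).
Local Notation p h := (\val (moment a h)).
Local Notation K := (skew (sd_proj a)).
Implicit Types (x y : K) (h : H).

(** The components h, g and g' of an element (h, g, g') of (H x| G) x_pi G. *)
Definition ss_h x : H := (\val (\val x).1).1.
Definition ss_g x : G := (\val (\val x).1).2.
Definition ss_w x : G := (\val x).2.

Lemma ss_inj x y :
  ss_h x = ss_h y -> ss_g x = ss_g y -> ss_w x = ss_w y -> x = y.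
Proof.
rewrite /ss_h /ss_g /ss_w => e1 e2 e3; apply: val_inj.
move: e1 e2 e3; case: (\val x) (\val y) => [s w] [s' w'] /= e1 e2 ->.
congr pair; apply: val_inj.
by move: e1 e2; case: (\val s) (\val s') => [? ?] [? ?] /= -> ->.
Qed.

Lemma ss_gP x : gter (ss_g x) = p (ss_h x).
Proof. exact: sd_setP. Qed.

Lemma ss_wg x : gdom (ss_w x) = gter (ss_g x).
Proof. exact: (skew_setP x). Qed.

Lemma ss_wP x : gter (ginv (ss_w x)) = p (ss_h x).
Proof. by rewrite gterV ss_wg ss_gP. Qed.

Lemma ss_compP x y : gcomp x y <->
  [/\ act a (gdom (ss_h x)) (ss_g x) = gter (ss_h y),
      gdom (ss_g x) = gter (ss_g y) & ss_w y = gmul (ss_w x) (ss_g x)].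
Proof.
split=> [/skew_compP[/(congr1 \val)]|[e1 e2 e3]].
  by rewrite val_sd_dom val_sd_ter => -[].
by apply/skew_compP; split => //; apply: sd_comp_intro.
Qed.

Lemma ss_hM x y : gcomp x y ->
  ss_h (gmul x y) = gmul (ss_h x) (act a (ss_h y) (ginv (ss_g x))).
Proof.
by move=> c; have /skew_compP[c' _] := c; rewrite /ss_h val_skew_mul//= val_sd_mul.
Qed.

Lemma ss_gM x y : gcomp x y -> ss_g (gmul x y) = gmul (ss_g x) (ss_g y).
Proof.
by move=> c; have /skew_compP[c' _] := c; rewrite /ss_g val_skew_mul//= val_sd_mul.
Qed.

Lemma ss_wM x y : gcomp x y -> ss_w (gmul x y) = ss_w x.
Proof. by move=> c; rewrite /ss_w val_skew_mul. Qed.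

Lemma ss_h_gter x : ss_h (gter x) = gter (ss_h x).
Proof. by rewrite /ss_h val_skew_ter/= val_sd_ter. Qed.

Lemma ss_w_gter x : ss_w (gter x) = ss_w x.
Proof. by rewrite /ss_w val_skew_ter. Qed.

Lemma ss_h_gdom x : ss_h (gdom x) = act a (gdom (ss_h x)) (ss_g x).
Proof. by rewrite /ss_h val_skew_dom/= val_sd_dom. Qed.

Lemma ss_w_gdom x : ss_w (gdom x) = gmul (ss_w x) (ss_g x).
Proof. by rewrite /ss_w val_skew_dom. Qed.

Lemma ss_h_continuous : continuous ss_h.
Proof.
exact: continuous_fst (@continuous_sval _ _ (sd_set a) _
  (continuous_fst (@val_continuous _ (skew_set (sd_proj a))))).
Qed.

Lemma ss_w_continuous : continuous ss_w.
Proof. exact: continuous_snd (@val_continuous _ (skew_set (sd_proj a))). Qed.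

(** The element (h, g, w) of (H x| G) x_pi G. *)
Definition ss_elt (h : H) (g w : G) (e : gter g = p h) (e' : gdom w = gter g) :
  K := skew_elt (rho := sd_proj a) (g := sd_elt e) e'.

Lemma ss_eltE h g w e e' : let x := @ss_elt h g w e e' in
  ((ss_h x = h) * (ss_g x = g) * (ss_w x = w))%type.
Proof. by []. Qed.

Lemma ss_elt_continuous (X : topologicalType) (fh : X -> H) (fg fw : X -> G)
    (e : forall z, gter (fg z) = p (fh z))
    (e' : forall z, gdom (fw z) = gter (fg z)) :
  continuous fh -> continuous fg -> continuous fw ->
  continuous (fun z => ss_elt (e z) (e' z)).
Proof.
move=> ch cg cw; apply: continuous_val; apply: continuous_pair => //.
by apply: continuous_val; exact: continuous_pair.
Qed.

(** The homomorphism phi(h, g, g') = h . g'^-1. *)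
Definition ss_to_fun x : H := act a (ss_h x) (ginv (ss_w x)).

Lemma ss_to_comp x y : gcomp x y -> gcomp (ss_to_fun x) (ss_to_fun y).
Proof.
move=> /ss_compP[e1 e2 e3]; have wx := ss_wP x; have wy := ss_wP y.
rewrite /gcomp /ss_to_fun -act_gdom// -act_gter// -e1 e3.
rewrite ginvM; last exact: ss_wg.
rewrite actMr.
- by rewrite actK// moment_gdom ss_gP.
- by rewrite gterV moment_act// moment_gdom ss_gP.
- by rewrite /gcomp gdomV gterV ss_wg.
Qed.

Lemma ss_toM x y : gcomp x y ->
  ss_to_fun (gmul x y) = gmul (ss_to_fun x) (ss_to_fun y).
Proof.
move=> c; have /ss_compP[e1 e2 e3] := c; have wx := ss_wP x.
have my : gter (ginv (ss_g x)) = p (ss_h y) by rewrite gterV e2 ss_gP.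
have c' : gcomp (ss_h x) (act a (ss_h y) (ginv (ss_g x))).
  by rewrite /gcomp -act_gter// -e1 actK// moment_gdom ss_gP.
rewrite /ss_to_fun ss_hM// ss_wM// actMl//; congr gmul.
rewrite e3 ginvM; last exact: ss_wg.
by rewrite actMr// /gcomp gdomV gterV ss_wg.
Qed.

Lemma ss_to_continuous : continuous ss_to_fun.
Proof.
apply: continuous_act; [exact: ss_h_continuous| |exact: ss_wP].
exact: continuous_ginv ss_w_continuous.
Qed.

Definition ss_to : ghom K H := GHom ss_to_comp ss_toM ss_to_continuous.

Lemma gdom_moment h : gdom (p h) = p h.
Proof. exact: (set_mem (valP (moment a h))). Qed.

Lemma gdom_gter_moment h : gdom (p h) = gter (p h).
Proof. by rewrite gdom_moment moment_ter. Qed.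

(** The homomorphism psi(h) = (h, p(h), p(h)). *)
Definition ss_of_fun h : K := ss_elt (moment_ter a h) (gdom_gter_moment h).

Lemma moment_comp h1 h2 : gcomp h1 h2 -> p h1 = p h2.
Proof. by move=> c; have [<- <-] := @moment_mul _ _ a _ _ c. Qed.

Lemma gmul_moment h : gmul (p h) (p h) = p h.
Proof. by rewrite -{2}[p h]gdom_moment gmul_dom. Qed.

Lemma ginv_moment h : ginv (p h) = p h.
Proof. by rewrite -(moment_ter a h) ginv_gter. Qed.

Lemma ss_of_comp h1 h2 : gcomp h1 h2 -> gcomp (ss_of_fun h1) (ss_of_fun h2).
Proof.
move=> c; apply/ss_compP; rewrite /ss_h /ss_g /ss_w /=.
rewrite -(moment_comp c) gmul_moment gdom_gter_moment; split => //.
by rewrite -(moment_gdom a h1) act_moment.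
Qed.

Lemma ss_ofM h1 h2 : gcomp h1 h2 ->
  ss_of_fun (gmul h1 h2) = gmul (ss_of_fun h1) (ss_of_fun h2).
Proof.
move=> c; have c' := ss_of_comp c; have [m1 m2] := @moment_mul _ _ a _ _ c.
apply: ss_inj; rewrite ?ss_hM ?ss_gM ?ss_wM// /ss_h /ss_g /ss_w /=.
- by rewrite ginv_moment (moment_comp c) act_moment.
- by rewrite -(moment_comp c) m1 gmul_moment.
Qed.

Lemma ss_of_continuous : continuous ss_of_fun.
Proof.
have cp := continuous_sval (@moment_continuous _ _ a).
by apply: ss_elt_continuous => // x.
Qed.

Definition ss_of : ghom H K := GHom ss_of_comp ss_ofM ss_of_continuous.

Lemma ss_ofK : ss_to \o ss_of =1 id.
Proof. by move=> h /=; rewrite /ss_to_fun /ss_h /ss_w /= ginv_moment act_moment. Qed.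

Lemma ss_theta_subproof x : gdom (ss_w x) = gter (ginv (ss_w x)).
Proof. by rewrite gterV. Qed.

(** theta(u, v, w) = (u, w^-1, w), an arrow from psi(phi(u, v, w)) to (u, v, w)
    when the latter is a unit. *)
Definition ss_theta x : K := ss_elt (ss_wP x) (ss_theta_subproof x).

Lemma ss_theta_continuous : continuous ss_theta.
Proof.
have cw := ss_w_continuous.
apply: ss_elt_continuous => //; first exact: ss_h_continuous.
exact: continuous_ginv.
Qed.

Lemma ss_ofK_similar : hom_similar (ss_of \o ss_to) (@id K).
Proof.
apply: (hom_similar_restrict ss_theta_continuous) => x.
have wx := ss_wP x; have gx := ss_gP x; have wg := ss_wg x.
have px : p (ss_to_fun x) = gter (ss_w x) by rewrite moment_act// gdomV.
have c1 : gcomp (ss_theta (gter x)) (ss_of_fun (ss_to_fun x)).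
  apply/ss_compP; rewrite /ss_theta /ss_of_fun !ss_eltE ss_h_gter ss_w_gter.
  by rewrite px gdomV gter_ter gmulV gdom_ter -act_gter.
have c2 : gcomp x (ss_theta (gdom x)).
  apply/ss_compP; rewrite /ss_theta !ss_eltE ss_h_gdom ss_w_gdom gterV gdomM//.
  by rewrite -act_gter ?moment_gdom// gter_dom.
(* Both sides are (h, g'^-1, g'). *)
split => //; apply: ss_inj; rewrite ?ss_hM ?ss_gM ?ss_wM//.
- rewrite /ss_theta /ss_of_fun !ss_eltE ss_h_gter ss_w_gter ss_h_gdom.
  by rewrite !actK ?moment_gdom// gmul_ter gmul_dom.
- rewrite /ss_theta /ss_of_fun !ss_eltE ss_w_gter ss_w_gdom px -gdomV gmul_dom.
  by rewrite ginvM// gmul_cancellV// gterV.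
- by rewrite /ss_theta ss_eltE ss_w_gter.
Qed.

Lemma similar_skew_semidirect : similar K H.
Proof.
exists ss_to, ss_of; split; first exact: ss_ofK_similar.
exact: hom_similar_id ss_ofK.
Qed.

End SkewSemidirect.

(** * Semi-direct product of a skew product *)

Section SemidirectSkew.
Variables (G Gamma : topGroupoid) (rho : ghom G Gamma).
Local Notation L := (semidirect (skew_preaction rho)).
Implicit Types (x y : L) (g : G).

(** The components g, c and c' of an element (g, c, c') of
    (G x_rho Gamma) x| Gamma. *)
Definition sk_g x : G := (\val (\val x).1).1.
Definition sk_c x : Gamma := (\val (\val x).1).2.
Definition sk_c' x : Gamma := (\val x).2.

Lemma sk_inj x y :
  sk_g x = sk_g y -> sk_c x = sk_c y -> sk_c' x = sk_c' y -> x = y.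
Proof.
rewrite /sk_g /sk_c /sk_c' => e1 e2 e3; apply: val_inj.
move: e1 e2 e3; case: (\val x) (\val y) => [s w] [s' w'] /= e1 e2 ->.
congr pair; apply: val_inj.
by move: e1 e2; case: (\val s) (\val s') => [? ?] [? ?] /= -> ->.
Qed.

Lemma sk_cP x : gdom (sk_c x) = gter (rho (sk_g x)).
Proof. exact: (skew_setP (\val x).1). Qed.

Lemma sk_c'P x : gter (sk_c' x) = gter (sk_c x).
Proof. exact: (sd_setP x). Qed.

(** The action on the domain of (g, c), which enters the domain of
    (g, c, c'). *)
Lemma val_sk_act x :
  \val (skew_act (gdom (\val x).1) (\val x).2) =
  (gdom (sk_g x), gmul (ginv (sk_c' x)) (gmul (sk_c x) (rho (sk_g x)))).
Proof.
have e : \val (gdom (\val x).1) =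
  (gdom (sk_g x), gmul (sk_c x) (rho (sk_g x))) := val_skew_dom _.
rewrite val_skew_act ?e// val_skew_moment e gterM ?sk_cP//; exact: sk_c'P.
Qed.

Lemma sk_compP x y : gcomp x y <->
  [/\ gdom (sk_g x) = gter (sk_g y),
      gmul (ginv (sk_c' x)) (gmul (sk_c x) (rho (sk_g x))) = sk_c y &
      gdom (sk_c' x) = gter (sk_c' y)].
Proof.
split=> [/(congr1 \val)|[e1 e2 e3]].
  rewrite val_sd_dom val_sd_ter => -[/(congr1 \val)].
  by rewrite [X in X = _]val_sk_act val_skew_ter => -[].
apply: val_inj; rewrite val_sd_dom val_sd_ter; congr pair => //.
by apply: val_inj; rewrite [LHS]val_sk_act val_skew_ter e1 e2.
Qed.

Lemma val_sk_mul x y : gcomp x y ->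
  \val (gmul (\val x).1 (skew_act (\val y).1 (ginv (\val x).2))) =
  (gmul (sk_g x) (sk_g y), sk_c x).
Proof.
move=> c; have [_ e2 _ e4] := sd_compP c.
by rewrite val_skew_mul// val_skew_act.
Qed.

Lemma sk_gM x y : gcomp x y -> sk_g (gmul x y) = gmul (sk_g x) (sk_g y).
Proof. by move=> c; rewrite {1}/sk_g val_sd_mul// [\val _]val_sk_mul. Qed.

Lemma sk_cM x y : gcomp x y -> sk_c (gmul x y) = sk_c x.
Proof. by move=> c; rewrite {1}/sk_c val_sd_mul// [\val _]val_sk_mul. Qed.

Lemma sk_c'M x y : gcomp x y -> sk_c' (gmul x y) = gmul (sk_c' x) (sk_c' y).
Proof. by move=> c; rewrite {1}/sk_c' val_sd_mul. Qed.

Lemma sk_g_gter x : sk_g (gter x) = gter (sk_g x).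
Proof. by rewrite /sk_g val_sd_ter/= val_skew_ter. Qed.

Lemma sk_c_gter x : sk_c (gter x) = sk_c x.
Proof. by rewrite /sk_c val_sd_ter/= val_skew_ter. Qed.

Lemma sk_g_gdom x : sk_g (gdom x) = gdom (sk_g x).
Proof. by rewrite {1}/sk_g val_sd_dom [\val _]val_sk_act. Qed.

Lemma sk_c_gdom x :
  sk_c (gdom x) = gmul (ginv (sk_c' x)) (gmul (sk_c x) (rho (sk_g x))).
Proof. by rewrite {1}/sk_c val_sd_dom [\val _]val_sk_act. Qed.

Lemma sk_g_continuous : continuous sk_g.
Proof.
exact: continuous_fst (@continuous_sval _ _ (skew_set rho) _
  (continuous_fst (@val_continuous _ (sd_set (skew_preaction rho))))).
Qed.

Lemma sk_c_continuous : continuous sk_c.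
Proof.
exact: continuous_snd (@continuous_sval _ _ (skew_set rho) _
  (continuous_fst (@val_continuous _ (sd_set (skew_preaction rho))))).
Qed.

(** The element (g, c, c') of (G x_rho Gamma) x| Gamma. *)
Definition sk_elt (g : G) (c c' : Gamma) (e : gdom c = gter (rho g))
    (e' : gter c' = gter c) : L :=
  sd_elt (a := skew_preaction rho) (h := skew_elt e) e'.

Lemma sk_eltE g c c' e e' : let x := @sk_elt g c c' e e' in
  ((sk_g x = g) * (sk_c x = c) * (sk_c' x = c'))%type.
Proof. by []. Qed.

Lemma sk_elt_continuous (X : topologicalType) (fg : X -> G) (fc fc' : X -> Gamma)
    (e : forall z, gdom (fc z) = gter (rho (fg z)))
    (e' : forall z, gter (fc' z) = gter (fc z)) :
  continuous fg -> continuous fc -> continuous fc' ->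
  continuous (fun z => sk_elt (e z) (e' z)).
Proof.
move=> cg cc cc'; apply: continuous_val; apply: continuous_pair => //.
by apply: continuous_val; exact: continuous_pair.
Qed.

Lemma sk_to_comp x y : gcomp x y -> gcomp (sk_g x) (sk_g y).
Proof. by move=> /sk_compP[]. Qed.

(** The homomorphism phi(g, c, c') = g. *)
Definition sk_to : ghom L G := GHom sk_to_comp sk_gM sk_g_continuous.

Lemma sk_of_subproof1 g : gdom (rho (gter g)) = gter (rho g).
Proof. by rewrite ghom_ter gdom_ter. Qed.

Lemma sk_of_subproof2 g : gter (rho g) = gter (rho (gter g)).
Proof. by rewrite ghom_ter gter_ter. Qed.

(** The homomorphism psi(g) = (g, rho(t(g)), rho(g)). *)
Definition sk_of_fun g : L := sk_elt (sk_of_subproof1 g) (sk_of_subproof2 g).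

Lemma sk_of_comp g1 g2 : gcomp g1 g2 -> gcomp (sk_of_fun g1) (sk_of_fun g2).
Proof.
move=> c; have c' := ghom_comp rho c; apply/sk_compP.
rewrite /sk_of_fun !sk_eltE; split=> //.
by rewrite !ghom_ter gmul_ter gmulVx c'.
Qed.

Lemma sk_ofM g1 g2 : gcomp g1 g2 ->
  sk_of_fun (gmul g1 g2) = gmul (sk_of_fun g1) (sk_of_fun g2).
Proof.
move=> c; have c' := sk_of_comp c.
apply: sk_inj; rewrite ?sk_gM ?sk_cM ?sk_c'M// /sk_of_fun !sk_eltE.
- by rewrite gterM.
- by rewrite ghomM.
Qed.

Lemma sk_of_continuous : continuous sk_of_fun.
Proof.
have cr := @ghom_continuous _ _ rho; have ci : continuous (@id G) by move=> g.
apply: sk_elt_continuous => //.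
exact: continuous_compT cr (continuous_gter ci).
Qed.

Definition sk_of : ghom G L := GHom sk_of_comp sk_ofM sk_of_continuous.

Lemma sk_theta_subproof x : gdom (sk_c x) = gter (rho (gter (sk_g x))).
Proof. by rewrite ghom_ter gter_ter sk_cP. Qed.

(** theta(g, c, c') = (t(g), c, c), an arrow from psi(phi(g, c, c')) to
    (g, c, c') when the latter is a unit. *)
Definition sk_theta x : L := sk_elt (sk_theta_subproof x) (erefl (gter (sk_c x))).

Lemma sk_theta_continuous : continuous sk_theta.
Proof.
have cc := sk_c_continuous.
by apply: sk_elt_continuous => //; exact: continuous_gter sk_g_continuous.
Qed.

Lemma sk_ofK_similar : hom_similar (sk_of \o sk_to) (@id L).
Proof.
apply: (hom_similar_restrict sk_theta_continuous) => x.
have cx : gcomp (sk_c x) (rho (sk_g x)) := sk_cP x; have cx' := sk_c'P x.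
have c1 : gcomp (sk_theta (gter x)) (sk_of_fun (sk_g x)).
  apply/sk_compP; rewrite /sk_theta /sk_of_fun !sk_eltE sk_g_gter sk_c_gter.
  by rewrite gter_ter gdom_ter ghom_ter gmul_cancell /gcomp ?gter_ter.
have c2 : gcomp x (sk_theta (gdom x)).
  apply/sk_compP; rewrite /sk_theta !sk_eltE sk_g_gdom sk_c_gdom gter_dom.
  by rewrite gter_dom gterM ?gterV// gdomV gterM.
(* Both sides are (g, c, c rho(g)). *)
split => //; apply: sk_inj; rewrite ?sk_gM ?sk_cM ?sk_c'M//.
- rewrite /sk_theta /sk_of_fun !sk_eltE sk_g_gter sk_g_gdom.
  by rewrite gter_ter gter_dom gmul_ter gmul_dom.
- by rewrite /sk_theta !sk_eltE sk_c_gter.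
- rewrite /sk_theta /sk_of_fun !sk_eltE sk_c_gter sk_c_gdom.
  by rewrite gmul_cancellV// gterM.
Qed.

Lemma similar_semidirect_skew : similar L G.
Proof.
exists sk_to, sk_of; split; first exact: sk_ofK_similar.
by apply: hom_similar_id => g.
Qed.

End SemidirectSkew.

Theorem theorem3p8 (G H Gamma : topGroupoid)
  (etG : etale G) (etH : etale H) (etGamma : etale Gamma)
  (a : action H G) (rho : ghom G Gamma) :
  similar (skew (sd_proj a)) H /\ similar (semidirect (skew_preaction rho)) G.
Proof.
split; first exact: similar_skew_semidirect.
exact: similar_semidirect_skew.
Qed.
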